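(* Let $\mathscr I$ be an ideal on $\omega$. The following are equivalent: (1) There is $f\in\omega^\omega$ such that $\lim_{n\to\infty}f(n)=\infty$, $\lim_{n\to\infty}f(n)/2^n=0$ and $\mathscr I_L^f\le_{\mathrm{KB}}\mathscr I$. (2) $\mathscr I$ is not locally rapid.
   Context: Ideals on $\omega$ are assumed proper and to contain all finite sets. Let $(P_i^{\exp})_{i<\omega}$ be the interval partition of $\omega$ with $|P_i^{\exp}|=2^i$. For $f\in\omega^\omega$ with $\lim_nf(n)/2^n=0$, $\mathscr I_L^f=\{A\subseteq\omega:\exists k<\omega\,\forall^\infty i<\omega\ |A\cap P_i^{\exp}|\le k\cdot f(i)\}$. For ideals $\mathscr J,\mathscr I$ on $\omega$, $\mathscr J\le_{\mathrm{KB}}\mathscr I$ (Katětov–Blass reducibility) means there is a finite-to-one function $g\colon\omega\to\omega$ with $g^{-1}[A]\in\mathscr I$ for all $A\in\mathscr J$. Given a partition $\bar P=(P_i)_{i<\omega}$ of $\omega$ (pieces are allowed to be empty), $A\subseteq\omega$ is a linear selector of $\bar P$ if $|A\cap P_i|\le i$ for all $i<\omega$. An ideal $\mathscr I$ on $\omega$ is locally rapid if for every partition $\bar P=(P_i)_{i<\omega}$ of $\omega$ into finite sets there is a linear selector $A$ of $\bar P$ with $A\notin\mathscr I$. *)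

(* Defs.v *)
From mathcomp Require Import all_boot all_order all_algebra.
From mathcomp Require Import all_classical all_reals all_analysis.
Import Order.TTheory GRing.Theory Num.Theory.
Import numFieldNormedType.Exports.

Set Implicit Arguments.
Unset Strict Implicit.
Unset Printing Implicit Defensive.

Local Open Scope classical_set_scope.
Local Open Scope card_scope.
Local Open Scope nat_scope.

(* Ideals are proper and contain all finite sets, by convention. *)
Record is_ideal (I : set_system nat) : Prop := IsIdeal {
  ideal_finite : forall A, finite_set A -> I A;
  ideal_subset : forall A B, A `<=` B -> I B -> I A;
  ideal_setU : forall A B, I A -> I B -> I (A `|` B);
  ideal_proper : ~ I setT }.

(* Consecutive intervals with 2^i points; the i-th starts at
   1 + 2 + ... + 2^(i-1) = 2^i - 1. *)
Definition Pexp (i : nat) : set nat := [set n | 2 ^ i - 1 <= n < 2 ^ i.+1 - 1].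

(* B #<= `I_m says that B is finite with at most m elements. *)
Definition linear_growth_ideal (f : nat -> nat) : set_system nat :=
  [set A | exists k : nat,
     \forall i \near \oo, (A `&` Pexp i) #<= `I_(k * f i)].

Definition finite_to_one (g : nat -> nat) : Prop :=
  forall n, finite_set (g @^-1` [set n]).

Definition katetov_blass (J I : set_system nat) : Prop :=
  exists2 g : nat -> nat, finite_to_one g & forall A, J A -> I (g @^-1` A).

(* Unlike the library's [partition], this allows empty pieces. *)
Definition is_partition (P : nat -> set nat) : Prop :=
  trivIset setT P /\ \bigcup_i P i = setT.

Definition linear_selector (P : nat -> set nat) (A : set nat) : Prop :=
  forall i, (A `&` P i) #<= `I_i.

Definition locally_rapid (I : set_system nat) : Prop :=
  forall P : nat -> set nat, is_partition P -> (forall i, finite_set (P i)) ->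
  exists2 A, linear_selector P A & ~ I A.

(* Main.v *)
Require Import Defs.
From mathcomp Require Import all_boot all_order all_algebra.
From mathcomp Require Import all_classical all_reals all_analysis.
From mathcomp Require Import zify.
Import Order.TTheory GRing.Theory Num.Theory.
Import numFieldNormedType.Exports.

Local Open Scope classical_set_scope.
Local Open Scope ring_scope.

(** Suppose [g] witnesses (1). Since [f] tends to infinity, the sets
    [{x | f(n) = i}], where [n] is the index of the interval containing [g x],
    form a partition into finite sets, and the image under [g] of a linear
    selector of it has at most [f n] points in the [n]-th interval.

    Conversely, if all linear selectors of a partition [P] lie in the ideal,
    choose a nondecreasing [N] with [P_i] contained in [[0, N i)], let [g] embed
    [P_i] into the [N i]-th interval by translation, and let [f n] be the least
    [i] with [n <= N i]. The preimage of a set of the linear growth ideal meets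
    almost every [P_i] in at most [k i] points, so it is, up to a finite set,
    a union of [k] linear selectors. *)

Lemma card_le_IIP {T : Type} (A : set T) (m : nat) :
  (A #<= `I_m)%card <->
  exists2 h : T -> nat, (forall x, A x -> (h x < m)%N) & {in A &, injective h}.
Proof.
split=> [/pcard_leP[h]|[h hm hinj]].
  by exists h => [x Ax|]; [exact: (@funS _ _ _ _ h x Ax)|exact: inj].
apply: (@card_le_trans _ _ _ (h @` A)); last first.
  by apply: subset_card_le => _ [x Ax <-]; exact: hm.
by move: (inj_card_eq hinj); rewrite card_eq_le => /andP[].
Qed.

(** Replacing a partition by its coloring turns finiteness of all pieces into [finite_to_one c]. *)
Lemma partition_coloring (P : nat -> set nat) : is_partition P ->
  exists c : nat -> nat, P = fun i => c @^-1` [set i].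
Proof.
move=> [/trivIsetP trivP coverP].
have /choice[c Pc] x : exists i, P i x.
  have : setT x by [].
  by rewrite -coverP => -[i _ Pix]; exists i.
exists c; apply/funext => i; apply/seteqP; split=> [x Pix|x /= <-//].
apply/eqP/negPn/negP => ci.
have : (P (c x) `&` P i) x by split.
by rewrite trivP.
Qed.

Lemma coloring_partition (c : nat -> nat) :
  is_partition (fun i => c @^-1` [set i]).
Proof.
split; last by apply/seteqP; split=> // x _; exists (c x).
apply/trivIsetP => i j _ _ /eqP ij; apply/seteqP; split=> // x [/= ci cj].
by apply: ij; rewrite -ci.
Qed.

Lemma finite_to_one_comp (f g : nat -> nat) :
  finite_to_one f -> finite_to_one g -> finite_to_one (f \o g).
Proof.
move=> ff gf n.
have -> : (f \o g) @^-1` [set n] =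
    \bigcup_(m in f @^-1` [set n]) g @^-1` [set m].
  by apply/seteqP; split=> [x /= <-|x [m /= <- <-]//]; exists (g x).
by apply: bigcup_finite => // m _; exact: gf.
Qed.

Lemma cvgny_finite_to_one (f : nat -> nat) :
  f n @[n --> \oo] --> \oo -> finite_to_one f.
Proof.
move=> /cvgnyPgt f_oo n; have [m _ fm] := f_oo n.
apply: (sub_finite_set _ (finite_II m)) => x /= fx.
by rewrite ltnNge; apply/negP => /fm /=; rewrite fx ltnn.
Qed.

Lemma finite_preimage_II (c : nat -> nat) (m : nat) :
  finite_to_one c -> finite_set [set x | (c x < m)%N].
Proof.
move=> cf.
have -> : [set x | (c x < m)%N] = \bigcup_(i in `I_m) c @^-1` [set i].
  by apply/seteqP; split=> [x /= xm|x [i /= im ->//]]; exists (c x).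
by apply: bigcup_finite => // i _; exact: cf.
Qed.

(** Shifting by one carries the [i]-th interval to [[2^i, 2^(i+1))], where the binary logarithm is
    constant. *)
Lemma PexpP (i n : nat) : Pexp i n <-> trunc_log 2 n.+1 = i.
Proof.
have i0 : (0 < 2 ^ i)%N by rewrite expn_gt0.
have i1 : (0 < 2 ^ i.+1)%N by rewrite expn_gt0.
split=> [|<-]; rewrite /Pexp /=.
  by move=> /andP[a b]; apply: trunc_log_eq => //; apply/andP; split; lia.
have := @trunc_log_bounds 2 n.+1 isT isT.
set k := trunc_log 2 n.+1 => /= /andP[a b].
have k0 : (0 < 2 ^ k)%N by rewrite expn_gt0.
by apply/andP; split; lia.
Qed.

Lemma finite_Pexp : finite_to_one (fun n => trunc_log 2 n.+1).
Proof.
move=> i; apply: (sub_finite_set _ (finite_II (2 ^ i.+1))) => n /PexpP.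
by rewrite /Pexp /= => /andP[_]; lia.
Qed.

Section LinearSelectors.
Variables (I : set_system nat) (hI : is_ideal I) (c : nat -> nat).
Hypothesis cf : finite_to_one c.
Hypothesis selI : forall A, linear_selector (fun i => c @^-1` [set i]) A -> I A.

(** Induction on [k]: each new slice, with [h x] between [k * c x] and [k.+1 * c x], is a linear
    selector, because subtracting [k * c x] keeps [h] injective on each color class. *)
Lemma ideal_linear_slice (B : set nat) (h : nat -> nat) (k : nat) :
  (forall i, {in B `&` c @^-1` [set i] &, injective h}) ->
  I [set x | B x /\ (h x < k * c x)%N].
Proof.
move=> hinj; elim: k => [|k IHk].
  by apply: (ideal_subset hI (B := set0)) => [x [_]|]; rewrite ?mul0n//;
     exact: ideal_finite.
have slice : I [set x | [/\ B x, (k * c x <= h x)%N & (h x < k.+1 * c x)%N]].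
  apply: selI => i; apply/card_le_IIP; exists (fun x => (h x - k * c x)%N).
    by move=> x [[_ a b] /= ci]; rewrite ci in a b; lia.
  move=> x y; rewrite !inE => -[[Bx ax _] /= cx] [[By ay _] /= cy] e.
  apply: (hinj i); rewrite ?inE//; rewrite cx in ax e; rewrite cy in ay e.
  lia.
apply: ideal_subset hI _ _ _ (ideal_setU hI IHk slice) => x [Bx xk].
by case: (ltnP (h x) (k * c x)) => ?; [left|right].
Qed.

Lemma ideal_linear_growth (B : set nat) (k i0 : nat) :
  (forall i, (i0 <= i)%N -> (B `&` c @^-1` [set i] #<= `I_(k * i))%card) ->
  I B.
Proof.
move=> Bk.
have /choice[h hP] i : exists h : nat -> nat, (i0 <= i)%N ->
    (forall x, (B `&` c @^-1` [set i]) x -> (h x < k * i)%N) /\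
    {in B `&` c @^-1` [set i] &, injective h}.
  have [/Bk/card_le_IIP[h ? ?]|] := leqP i0 i; first by exists h.
  by exists id.
(* The rankings [h i] of the single classes are glued into [x |-> h (c x) x]; the colors below [i0]
   contribute only a finite set. *)
pose B' := B `&` [set x | (i0 <= c x)%N].
have : I [set x | B' x /\ (h (c x) x < k * c x)%N].
  apply: (@ideal_linear_slice B' (fun x => h (c x) x)) => i x y.
  rewrite !inE => -[[Bx /= ix] cx] [[By /= iy] cy].
  rewrite cx cy in ix iy *.
  by apply: (hP i ix).2; rewrite inE.
move=> /(ideal_setU hI (ideal_finite hI (finite_preimage_II _ i0 cf))).
apply: ideal_subset hI _ _ _ => x Bx.
case: (ltnP (c x) i0) => ix; first by left.
by right; split=> //; apply: (hP _ ix).1.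
Qed.

End LinearSelectors.

(** This amounts to [n / 2^n <= 2 / (n+1)], a comparison with the harmonic sequence. *)
Lemma leq_mul_succ_exp2 (n : nat) : (n * n.+1 <= 2 * 2 ^ n)%N.
Proof.
elim: n => // n IHn; have := ltn_expl n (ltnSn 1); rewrite expnS; lia.
Qed.

Lemma cvg_div_exp2 (R : realType) (f : nat -> nat) :
  (forall n, (f n <= n)%N) ->
  ((f n)%:R / 2 ^+ n : R) @[n --> \oo] --> (0 : R).
Proof.
move=> fn.
have h0 : (2 * harmonic n : R) @[n --> \oo] --> (0 : R).
  by rewrite -[X in _ --> X](mulr0 2); apply: cvgMr; exact: cvg_harmonic.
apply: (squeeze_cvgr _ (@cvg_cst _ _ _ _ _) h0).
near=> n.
rewrite divr_ge0 ?exprn_ge0//= ler_pdivrMr ?exprn_gt0// mulrAC.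
rewrite ler_pdivlMr ?ltr0n// -natrX -!natrM ler_nat.
by apply: leq_trans (leq_mul_succ_exp2 n); rewrite leq_mul2r fn orbT.
Unshelve. all: by end_near. Qed.

Lemma katetov_blass_not_locally_rapid (I : set_system nat) (f : nat -> nat) :
  is_ideal I -> f n @[n --> \oo] --> \oo ->
  katetov_blass (linear_growth_ideal f) I -> ~ locally_rapid I.
Proof.
move=> hI f_oo [g gf gI].
pose l n := trunc_log 2 n.+1; pose c := f \o (l \o g).
have cf : finite_to_one c.
  apply: finite_to_one_comp; first exact: cvgny_finite_to_one.
  by apply: finite_to_one_comp; first exact: finite_Pexp.
move=> /(_ _ (coloring_partition c) cf)[A selA]; apply.
apply: (ideal_subset hI (B := g @^-1` (g @` A))).
  by move=> x Ax; exists x.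
apply: gI; exists 1%N; near=> n; rewrite mul1n.
apply: (card_le_trans _ (selA (f n))).
(* The class of color [f n] may come from several intervals, but it contains all points that [g]
   sends into the [n]-th one. *)
apply: (@card_le_trans _ _ _ (g @` (A `&` c @^-1` [set f n]))).
  apply: subset_card_le => _ [[x Ax <-] /PexpP gx]; exists x => //.
  by split=> //=; rewrite /c /= /l gx.
exact: card_image_le.
Unshelve. all: by end_near. Qed.

Lemma monotone_bound (c : nat -> nat) : finite_to_one c ->
  exists N : nat -> nat, [/\ {homo N : i j / (i <= j)%N},
    forall i, (i <= N i)%N & forall x, (x < N (c x))%N].
Proof.
move=> cf.
have /choice[m mP] i : exists m, forall x, c x = i -> (x < m)%N.
  have /finite_seqP[s sE] := cf i; exists (\max_(x <- s) x).+1 => x ci.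
  have : [set` s] x by rewrite -sE.
  by move=> /= xs; rewrite ltnS; exact: (@leq_bigmax_seq _ _ xpredT id).
(* The running maximum makes [N] monotone, and the summand [j] ensures [i <= N i]. *)
pose N i := (\max_(j < i.+1) (m j + j))%N.
have Nge i : (m i + i <= N i)%N.
  exact: (leq_bigmax (F := fun j : 'I_i.+1 => (m j + j)%N) ord_max).
exists N; split=> [i j ij|i|x].
- apply/bigmax_leqP => u _.
  have uj : (u < j.+1)%N by apply: leq_trans (ltn_ord u) _.
  exact: (leq_bigmax (F := fun j : 'I__ => (m j + j)%N) (Ordinal uj)).
- exact: leq_trans (leq_addl _ _) (Nge i).
- apply: leq_trans (mP _ _ erefl) _.
  exact: leq_trans (leq_addr _ _) (Nge _).
Qed.

Lemma not_locally_rapid_katetov_blass (R : realType) (I : set_system nat) :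
  is_ideal I -> ~ locally_rapid I ->
  exists f : nat -> nat,
     [/\ f n @[n --> \oo] --> \oo,
         ((f n)%:R / 2 ^+ n : R) @[n --> \oo] --> (0 : R)
       & katetov_blass (linear_growth_ideal f) I].
Proof.
move=> hI /existsNP[P /not_implyP[/partition_coloring[c ->]]].
move=> /not_implyP[cf noA].
have selI A : linear_selector (fun i => c @^-1` [set i]) A -> I A.
  by move=> selA; apply: contrapT => nIA; apply: noA; exists A.
have [N [Nmono Nge cN]] := monotone_bound c cf.
have Nex n : exists i, (n <= N i)%N by exists n.
(* A generalized inverse of [N]: [f (N i) <= i] will turn the bound [k * f (N i)] into [k * i], and
   [f n <= n] gives the limit against [2^n]. *)
pose f n := ex_minn (Nex n).
have fN n : (n <= N (f n))%N by rewrite /f; case: ex_minnP.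
have f_min n i : (n <= N i)%N -> (f n <= i)%N.
  by rewrite /f; case: ex_minnP => ? _; apply.
exists f; split.
- apply/cvgnyPgt => K; exists (N K).+1 => // n /= Kn.
  rewrite ltnNge; apply/negP => /Nmono.
  by have := fN n; lia.
- by apply: cvg_div_exp2 => n; exact: f_min.
(* The shift is the left end of the [N (c x)]-th interval, which has room since
   [x < N (c x) < 2 ^ N (c x)]. *)
- pose g x := (2 ^ N (c x) - 1 + x)%N.
  exists g.
    move=> n; apply: (sub_finite_set _ (finite_II n.+1)) => x /= <-.
    by rewrite /g; lia.
  move=> A [k [n0 _ Ak]].
  apply: (@ideal_linear_growth I hI c cf selI (g @^-1` A) k n0) => i ni.
  (* As [i <= N i], the threshold [n0] for intervals also serves for colors. *)
  have /card_le_IIP[h hk hinj] := Ak (N i) (leq_trans ni (Nge i)).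
  have gP x : c x = i -> Pexp (N i) (g x).
    move=> <-; have := cN x; rewrite /g /Pexp /= expnS.
    have := ltn_expl (N (c x)) (ltnSn 1).
    by move=> *; apply/andP; split; lia.
  apply/card_le_IIP; exists (h \o g) => [x [/= Ax cx]|x y].
    apply: leq_trans (hk _ _) _; first by split=> //; exact: gP.
    by rewrite leq_mul2l f_min ?orbT.
  rewrite !inE => -[/= Ax cx] [/= Ay cy] e.
  have: g x = g y by apply: hinj e; rewrite inE; split=> //; exact: gP.
  by rewrite /g cx cy; lia.
Qed.

Theorem proposition6p12 (R : realType) (I : set_system nat) (hI : is_ideal I) :
  (exists f : nat -> nat,
     [/\ f n @[n --> \oo] --> \oo,
         ((f n)%:R / 2 ^+ n : R) @[n --> \oo] --> (0 : R)
       & katetov_blass (linear_growth_ideal f) I])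
  <-> ~ locally_rapid I.
Proof.
split=> [[f [f_oo _ fI]]|]; last exact: not_locally_rapid_katetov_blass.
exact: katetov_blass_not_locally_rapid fI.
Qed.
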